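(* Let $\{\alpha_n\}_{n\in\mathbb{N}}$ be a sequence of continuous actions of a topological group $G$ on compact metric spaces $(X_n,d_n)$, and let $p\ge 1$. For every $n\in\mathbb{N}$ let $(\alpha_n)_*$ be the induced action of $\alpha_n$ on $P_p(X_n)$. If $\lim_{n\to\infty}d_{mGH}(\alpha_n,\alpha)=0$ for some continuous action $\alpha$ of $G$ on a compact metric space $(X,d)$, then $\lim_{n\to\infty}d_{mGH}((\alpha_n)_*,\alpha_* )=0$, where $\alpha_*$ is the induced action of $\alpha$ on $P_p(X)$.
   Context: For an action $\alpha$ write $\alpha_g$ for the map given by $g\in G$. For a compact metric space $(X,d)$, $P_p(X)$ is the set of all Borel probability measures on $X$ with the Wasserstein metric $W_p(\mu,\nu)=\left(\inf_{\pi}\int_{X\times X}d(x_1,x_2)^p\,d\pi(x_1,x_2)\right)^{1/p}$, where $\pi$ ranges over all Borel probability measures on $X\times X$ with marginals $\mu$ and $\nu$. The induced action $\alpha_*$ of $G$ on $P_p(X)$ is $(\alpha_* )_g\mu=(\alpha_g)_*\mu$ (push-forward of measures). An $\varepsilon$-isometry $f:(X,d_X)\to(Y,d_Y)$ is a map (not necessarily continuous) with $|d_Y(f(x_1),f(x_2))-d_X(x_1,x_2)|\le\varepsilon$ for all $x_1,x_2\in X$ and such that every $y\in Y$ satisfies $d_Y(y,f(x))\le\varepsilon$ for some $x\in X$. For actions $\alpha,\beta$ of $G$ on metric spaces $X,Y$, an $\varepsilon$-measurable GHA from $\alpha$ to $\beta$ is a Borel $\varepsilon$-isometry $f:X\to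 Y$ with $\sup_{x\in X}d_Y(\beta_g(f(x)),f(\alpha_g(x)))\le\varepsilon$ for every $g\in G$. The distance $d_{mGH}(\alpha,\beta)$ is the infimum of the $\varepsilon>0$ for which there exist both an $\varepsilon$-measurable GHA from $\alpha$ to $\beta$ and an $\varepsilon$-measurable GHA from $\beta$ to $\alpha$ (with $\inf\varnothing=+\infty$). *)

(* Defs.v *)
From HB Require Import structures.
From mathcomp Require Import all_boot all_order all_algebra.
From mathcomp Require Import all_classical all_reals all_analysis.

Set Implicit Arguments.
Unset Strict Implicit.
Unset Printing Implicit Defensive.

Import Order.TTheory GRing.Theory Num.Theory.
Import numFieldNormedType.Exports.

Local Open Scope classical_set_scope.
Local Open Scope ring_scope.

HB.mixin Record Group_isTopological G & Topological G & Group G := {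
  mulg_continuous : continuous (fun xy : G * G => (xy.1 * xy.2)%g) ;
  invg_continuous : continuous (fun x : G => (x^-1)%g)
}.

#[short(type="topologicalGroupType")]
HB.structure Definition TopologicalGroup :=
  {G of Topological G & Group G & Group_isTopological G}.

(* A measurableType is pointed, so the spaces carrying measures must be
   nonempty; the choice of the point is irrelevant to everything below. *)
#[short(type="pointedMetricType")]
HB.structure Definition PointedMetric (R : numDomainType) :=
  {M of Metric R M & Pointed M}.

Record is_action (G : groupType) (X : Type) (a : G -> X -> X) : Prop := {
  is_action1 : forall x, a 1%g x = x ;
  is_actionM : forall g h x, a (g * h)%g x = a g (a h x)
}.

Record continuous_action (G : topologicalGroupType) (X : topologicalType) := {
  act :> G -> X -> X ;
  act_is_action : is_action act ;
  act_continuous : continuous (fun gx : G * X => act gx.1 gx.2)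
}.

(* Metric notions are stated for a type with an explicit distance function, so
   that they apply both to the spaces X, through mdist, and to the spaces
   P_p(X), through the Wasserstein distance. *)
Section measurable_gromov_hausdorff.
Context {R : realType}.

Definition dist_open (X : Type) (d : X -> X -> R) : set (set X) :=
  [set U | forall x, U x ->
    exists2 e : R, 0 < e & [set y | d x y < e] `<=` U].

Definition dist_borel (X : Type) (d : X -> X -> R) : set (set X) :=
  <<s dist_open d >>.

Lemma dist_open_mdist (X : metricType R) : dist_open (@mdist R X) = open.
Proof.
apply/seteqP; split => U /=.
- move=> dU; rewrite openE => x /dU[e e0 xeU].
  by apply/nbhs_ballP; exists e => //=; rewrite ballEmdist.
- rewrite openE => oU x /oU /nbhs_ballP[e /= e0 xeU].
  by exists e => //; rewrite -ballEmdist.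
Qed.

Variables (X Y : Type) (dX : X -> X -> R) (dY : Y -> Y -> R).

Definition eps_isometry (e : R) (f : X -> Y) : Prop :=
  (forall x1 x2, `|dY (f x1) (f x2) - dX x1 x2| <= e) /\
  (forall y, exists x, dY y (f x) <= e).

Definition borel_map (f : X -> Y) : Prop :=
  forall B, dist_borel dY B -> dist_borel dX (f @^-1` B).

Definition measurable_GHA (G : Type) (a : G -> X -> X) (b : G -> Y -> Y)
    (e : R) (f : X -> Y) : Prop :=
  [/\ borel_map f, eps_isometry e f &
      forall g, (ereal_sup [set (dY (b g (f x)) (f (a g x)))%:E | x in setT]
                 <= e%:E)%E].

End measurable_gromov_hausdorff.

Definition dmGH {R : realType} (X Y : Type) (dX : X -> X -> R)
    (dY : Y -> Y -> R) (G : Type) (a : G -> X -> X) (b : G -> Y -> Y) : \bar R :=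
  ereal_inf [set e%:E | e in [set e : R | [/\ 0 < e,
    exists f, measurable_GHA dX dY a b e f &
    exists f, measurable_GHA dY dX b a e f]]].

HB.instance Definition _ (X Y : ptopologicalType) := Pointed.on (X * Y)%type.

Definition borel (X : ptopologicalType) := g_sigma_algebraType (@open X).

(* As everywhere in the library, a measure is a function on all sets, constrained
   on the measurable ones only. Measures that agree on the Borel sets have the
   same couplings, hence are at Wasserstein distance 0, belong to the same
   dist_open sets and have push-forwards with the same property; so dmGH takes
   the same value on this type as on its quotient by that relation. *)
Definition borel_probability (R : realType) (X : ptopologicalType) :=
  probability (borel X) R.

Section wasserstein.
Context {R : realType}.
Variable X : pointedMetricType R.

Definition coupling (mu nu : borel_probability R X) :
    set (borel_probability R (X * X)%type) :=
  [set pi | forall A : set (borel X), measurable A ->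
    pi (fst @^-1` A) = mu A /\ pi (snd @^-1` A) = nu A].

(* When X is compact the integrals are bounded by a common real number and the
   product measure is a coupling, so the infimum is a real number and fine
   loses nothing. *)
Definition wasserstein (p : R) (mu nu : borel_probability R X) : R :=
  fine (ereal_inf [set (\int[pi]_z (mdist z.1 z.2 `^ p)%:E)%E
                  | pi in coupling mu nu]) `^ p^-1.

End wasserstein.

Section push_forward_action.
Context {R : realType} {G : topologicalGroupType} {X : ptopologicalType}.
Variable a : continuous_action G X.

Lemma act_measurable (g : G) :
  measurable_fun setT (a g : borel X -> borel X).
Proof.
apply: (@measurability _ _ (borel X) (borel X) _ _ (@open X)) => //.
move=> _ [U oU <-]; rewrite setTI; apply: sub_sigma_algebra.
apply: open_comp => // x _ V aV.
have [[A B] /= [gA xB] ABV] := @act_continuous _ _ a (g, x) V aV.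
apply: (filterS _ xB) => y By; apply: (ABV (g, y)); split => //=.
exact: nbhs_singleton.
Qed.

Definition act_mfun (g : G) : {mfun borel X >-> borel X} :=
  HB.pack (a g : borel X -> borel X)
    (isMeasurableFun.Build _ _ _ _ _ (act_measurable g)).

Definition induced_action (g : G) (mu : borel_probability R X) :
    borel_probability R X :=
  distribution mu (act_mfun g).

Lemma eq_borel_probability (mu nu : borel_probability R X) :
  mu = nu :> (set (borel X) -> \bar R) -> mu = nu.
Proof.
case: mu => mu [m1 [m2] [m3] [m4] [m5] [m6] [m7]].
case: nu => nu [n1 [n2] [n3] [n4] [n5] [n6] [n7]] /= munu; subst nu.
have m1n1 : m1 = n1.
  by case: m1 n1 {m2 n2} => [? ?] [? ?]; congr isContent.Axioms_;
    exact: Prop_irrelevance.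
subst n1; rewrite (Prop_irrelevance m2 n2) (Prop_irrelevance m3 n3).
rewrite (Prop_irrelevance m4 n4) (Prop_irrelevance m5 n5).
by rewrite (Prop_irrelevance m6 n6) (Prop_irrelevance m7 n7).
Qed.

Lemma induced_action_is_action : is_action induced_action.
Proof.
split=> [mu|g h mu]; apply: eq_borel_probability; apply/funext => A /=.
- rewrite /distribution /pushforward; congr (mu _).
  by apply/seteqP; split=> x /=; rewrite (is_action1 (act_is_action a)).
- rewrite /distribution /pushforward; congr (mu _).
  by apply/seteqP; split=> x /=; rewrite (is_actionM (act_is_action a)).
Qed.

End push_forward_action.

(* Main.v *)
From HB Require Import structures.
Require Import Defs.
From mathcomp Require Import all_boot all_order all_algebra.
From mathcomp Require Import all_classical all_reals all_analysis.
From mathcomp Require Import finmap measurable_realfun lra.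

Set Implicit Arguments.
Unset Strict Implicit.
Unset Printing Implicit Defensive.

Import Order.TTheory GRing.Theory Num.Theory.
Import numFieldNormedType.Exports.

Local Open Scope classical_set_scope.
Local Open Scope ring_scope.

(** If f is an e-measurable GHA from alpha to beta, then the push-forward f_* is
    a 2e-measurable GHA from alpha_* to beta_*. Hence the distance from alpha_* to
    beta_* is at most twice the distance from alpha to beta, and the theorem
    follows by squeezing. Simplifying f first, for instance to a nearby map with
    finitely many values, could ruin the equivariance bound, because the maps
    beta_g need not be equicontinuous in g: the push-forward of f itself has to
    be shown to be an almost isometry and to be Borel.

    The main tool is a partition of a compact space into finitely many Borel cells of
    small diameter (fine_labelling), together with the freedom to prescribe a
    coupling on the blocks of such a partition: any nonnegative matrix whose row
    and column sums are the masses of the cells under mu and nu is the matrix of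
    block masses of some coupling of mu and nu (coupling_with_block_masses),
    obtained by rescaling the product measure on each block.

    Metric distortion. A nearly optimal coupling on one side is read on blocks
    and rebuilt on the other side with the same block masses. When distances
    between matched cells differ by at most h, the costs are compared by
    Minkowski's inequality in L^p, and the Wasserstein distances differ by at
    most h (wasserstein_transfer). With the cells of a fine partition of Y on one
    side and their preimages under f on the other, this gives both inequalities,
    with h as close to e as desired. In particular a coupling of f_*mu and f_*nu
    lifts to X although f need be neither injective nor continuous.

    Equivariance and almost surjectivity. If two maps u and v are h-close, then
    u_*nu and v_*nu are at distance at most h, through the coupling (u, v)_*nu
    (wasserstein_distribution_le).

    Borel measurability of f_* for the Wasserstein metrics. On the source side,
    mu |-> mu(A) is Borel for every Borel set A: for A open it is lower
    semicontinuous by Markov's inequality, and the general case follows by the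
    pi-lambda theorem (measurable_evaluation). On the target side, two measures
    that give nearly the same masses to the cells of a fine partition are close
    (wasserstein_lt_close_masses), so that every open set of P_p(Y) is a countable
    union of sets defined by the masses of countably many cells. The preimages of
    these sets under f_* are defined by the masses of the preimages of the cells
    (borel_map_distribution). *)

(** * Finite Borel partitions of compact metric spaces *)

(** A partition into measurable cells, given by the map from points to indices
    of cells: preimages and products of partitions are then compositions and
    pairs of maps. *)
Definition measurable_labelling d (T : measurableType d) (I : Type)
    (q : T -> I) := forall i, measurable (q @^-1` [set i]).

(** The cells of the cover by the sets p c for c in s, each point being assigned
    to the first set of the cover that contains it. *)
Lemma measurable_find d (T : measurableType d) (C : Type) (p : C -> T -> bool)
    (s : seq C) (n : nat) :
  (forall c, measurable [set x | p c x]) ->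
  measurable [set x | find (p^~ x) s = n].
Proof.
move=> mp; elim: s n => [|c s IHs] n /=.
  by have [<-|n0] := eqVneq 0%N n;
    [rewrite (_ : [set _ | _] = setT)|rewrite (_ : [set _ | _] = set0)] => //;
    apply/seteqP; split=> // x /= /eqP; rewrite (negbTE n0).
case: n => [|n].
  rewrite [X in measurable X](_ : _ = [set x | p c x])//.
  by apply/seteqP; split=> x /=; case: (p c x).
rewrite [X in measurable X](_ : _ =
    ~` [set x | p c x] `&` [set x | find (p^~ x) s = n]).
  by apply: measurableI => //; apply: measurableC.
apply/seteqP; split=> x /=; case: (p c x) => //; first by case=> ->.
  by move=> [].
by move=> [_ ->].
Qed.

Definition mfun_of d d' (T : measurableType d) (T' : measurableType d')
    (f : T -> T') (mf : measurable_fun setT f) : {mfun T >-> T'} :=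
  HB.pack f (isMeasurableFun.Build _ _ _ _ _ mf).

Section compact_metric.
Context {R : realType}.
Implicit Type X : pointedMetricType R.

Lemma open_measurable_borel (X : ptopologicalType) (U : set X) :
  open U -> measurable (U : set (borel X)).
Proof. exact: sub_sigma_algebra. Qed.

Lemma open_mdist_lt X (x : X) (r : R) : open [set y | mdist x y < r].
Proof.
rewrite -dist_open_mdist => y /= xyr.
exists (r - mdist x y) => [|z /= yz]; first by rewrite subr_gt0.
by have := metric_triangle x y z; lra.
Qed.

(** A finite cover by balls, made disjoint. *)
Lemma fine_labelling X (e : R) : compact [set: X] -> 0 < e ->
  exists N (q : borel X -> 'I_N), measurable_labelling q /\
    forall x y : X, q x = q y -> mdist x y <= e.
Proof.
rewrite compact_cover => cX e0.
have e20 : 0 < e / 2 by rewrite divr_gt0.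
have [||D _ covD] := cX X setT (fun c => [set x | mdist c x < e / 2]).
- by move=> c _; exact: open_mdist_lt.
- by move=> x _; exists x => //=; rewrite mdistxx.
pose p (c x : X) := mdist c x < e / 2.
pose s := enum_fset D.
have ps x : (find (p^~ x) s < size s)%N.
  rewrite -has_find; apply/hasP.
  by have [c cD cx] := covD x Logic.I; exists c.
exists (size s), (fun x => Ordinal (ps x)); split=> [i|x y].
  rewrite [X in measurable X](_ : _ = [set x | find (p^~ x) s = i]).
    apply: (@measurable_find _ (borel X)) => c; apply: open_measurable_borel.
    exact: open_mdist_lt.
  apply/seteqP; split=> x /=; first by move=> <-.
  by move=> xi; apply/val_inj.
move=> /(congr1 val) /= xy.
have := @nth_find _ point (p^~ x) s; rewrite has_find => /(_ (ps x)).
have := @nth_find _ point (p^~ y) s; rewrite has_find => /(_ (ps y)).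
rewrite xy; set c := nth _ _ _; rewrite /p => cy cx.
rewrite (le_trans (metric_triangle _ c _))// (splitr e) lerD//.
- by rewrite metric_sym ltW.
- exact: ltW.
Qed.

(** The Borel sigma-algebra of X * X is contained in the product of those of X:
    an open set of X * X is the countable union, over partitions of mesh
    1/(n+1), of the products of cells that it contains. The product of two Borel
    measures, which lives on the product sigma-algebra, is thereby a Borel
    measure on X * X. *)
Lemma measurable_fun_borel_pair d (Z : measurableType d) X (u v : Z -> borel X) :
  compact [set: X] -> measurable_fun setT u -> measurable_fun setT v ->
  measurable_fun setT (fun z => (u z, v z) : borel (X * X)%type).
Proof.
move=> cX mu mv; apply: (@measurability _ _ _ (borel (X * X)%type) _ _ open) => //.
move=> _ [U oU <-]; rewrite setTI.
have labn n : {N : nat & {q : borel X -> 'I_N | measurable_labelling q /\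
    forall x y : X, q x = q y -> mdist x y <= n.+1%:R^-1}}.
  have [N Nq] := cid (@fine_labelling X n.+1%:R^-1 cX ltac:(by [])).
  by exists N; exact: cid.
pose N n := projT1 (labn n); pose q n : borel X -> 'I_(N n) := sval (projT2 (labn n)).
have qP n : measurable_labelling (q n) /\
    forall x y : X, q n x = q n y -> mdist x y <= n.+1%:R^-1.
  exact: svalP (projT2 (labn n)).
rewrite [X in measurable X](_ : _ = \bigcup_n \bigcup_(ij in
    [set ij : 'I_(N n) * 'I_(N n) |
      forall x y, q n x = ij.1 -> q n y = ij.2 -> U (x, y)])
    (u @^-1` (q n @^-1` [set ij.1]) `&` v @^-1` (q n @^-1` [set ij.2]))).
  apply: bigcupT_measurable => n; apply: fin_bigcup_measurable => // ij _.
  have [mq _] := qP n.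
  apply: measurableI; rewrite -[X in measurable X]setTI.
  - by apply: mu => //; exact: mq.
  - by apply: mv => //; exact: mq.
apply/seteqP; split=> [z Uz|z [n _ [[i j] /= ijU [ui vj]]]]; last exact: ijU.
have [[A B] /= [/nbhs_ballP[a /= a0 aA] /nbhs_ballP[b /= b0 bB]] ABU] :
  nbhs (u z, v z) U by exact: open_nbhs_nbhs.
have [n nab] : exists n, (n.+1%:R^-1 < Num.min a b)%R.
  have /(_ ltac:(by rewrite lt_min a0)) := @ltr_add_invr R 0 (Num.min a b).
  by move=> [k]; rewrite add0r; exists k.
exists n => //; exists (q n (u z), q n (v z)) => //= x y qx qy.
have [_ dq] := qP n; apply: (ABU (x, y)); split => /=.
- apply: aA; rewrite ballEmdist /=; apply: le_lt_trans (dq _ _ (esym qx)) _.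
  by rewrite (lt_le_trans nab)// ge_min lexx.
- apply: bB; rewrite ballEmdist /=; apply: le_lt_trans (dq _ _ (esym qy)) _.
  by rewrite (lt_le_trans nab)// ge_min lexx orbT.
Qed.

Lemma measurable_mdist X :
  measurable_fun setT (fun z : borel (X * X)%type => mdist z.1 z.2).
Proof.
apply: (measurability _ (RGenInftyO.measurableE R)).
move=> _ [_ [r ->] <-]; rewrite setTI; apply: open_measurable_borel.
rewrite openE => -[x y]; rewrite /= in_itv /= => xyr.
pose e := (r - mdist x y) / 2.
have e0 : 0 < e by rewrite divr_gt0// subr_gt0.
exists (ball x e, ball y e) => /=; first by split; exact: nbhsx_ballx.
move=> [x' y'] /=; rewrite !ballEmdist /= in_itv /= => -[xx' yy'].
have := metric_triangle x' x y'; have := metric_triangle x y y'.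
rewrite (metric_sym x' x); move: xx' yy'; rewrite /e; lra.
Qed.

Lemma measurable_mdist_ge X (r : R) :
  measurable ([set z | r <= mdist z.1 z.2] : set (borel (X * X)%type)).
Proof.
rewrite (_ : [set _ | _] = (fun z => mdist z.1 z.2) @^-1` `[r, +oo[).
  by rewrite -[X in measurable X]setTI; exact: measurable_mdist.
by apply/seteqP; split=> z /=; rewrite in_itv /= andbT.
Qed.

Lemma measurable_fst_borel X :
  measurable_fun setT (fst : borel (X * X)%type -> borel X).
Proof.
apply: (@measurability _ _ _ (borel X) _ _ open) => // _ [U oU <-].
rewrite setTI; apply: open_measurable_borel.
by apply: (@open_comp (X * X)%type X) => // x _; exact: cvg_fst.
Qed.

Lemma measurable_snd_borel X :
  measurable_fun setT (snd : borel (X * X)%type -> borel X).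
Proof.
apply: (@measurability _ _ _ (borel X) _ _ open) => // _ [U oU <-].
rewrite setTI; apply: open_measurable_borel.
by apply: (@open_comp (X * X)%type X) => // x _; exact: cvg_snd.
Qed.

Lemma mdist_bounded X : compact [set: X] ->
  exists2 D : R, 0 < D & forall x y : X, mdist x y <= D.
Proof.
move=> cX; have [N [q [_ dq]]] := @fine_labelling X 1 cX ltr01.
pose c i := if pselect (exists x, q x = i) is left h then sval (cid h) else point.
have cE x : q (c (q x)) = q x.
  by rewrite /c; case: pselect => [h|[]]; [case: cid|exists x].
pose M := \sum_(i < N) \sum_(j < N) mdist (c i) (c j).
have M0 : 0 <= M by apply: sumr_ge0 => i _; apply: sumr_ge0 => j _; exact: mdist_ge0.
exists (M + 2) => [|x y]; first by lra.
have cM : mdist (c (q x)) (c (q y)) <= M.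
  rewrite /M (bigD1 (q x))//= (bigD1 (q y))//= -addrA lerDl addr_ge0//.
    by apply: sumr_ge0 => j _; exact: mdist_ge0.
  by apply: sumr_ge0 => i _; apply: sumr_ge0 => j _; exact: mdist_ge0.
have := metric_triangle x (c (q x)) y.
have := metric_triangle (c (q x)) (c (q y)) y.
have := dq _ _ (cE y); have := dq _ _ (esym (cE x)); lra.
Qed.

End compact_metric.

(** * Couplings with prescribed block masses *)

Section couplings.
Context {R : realType}.

Lemma measure_lincomb d (T : measurableType d) (K : Type) (s : seq K)
    (c : K -> {nonneg R}) (m : K -> {measure set T -> \bar R}) :
  exists mu : {measure set T -> \bar R}, forall E,
    mu E = (\sum_(k <- s) (c k)%:num%:E * m k E)%E.
Proof.
elim: s => [|k s [mu muE]].
  by exists mzero => E; rewrite big_nil.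
exists (measure_add (mscale (c k) (m k)) mu) => E.
by rewrite big_cons [LHS]measure_addE muE.
Qed.

Lemma measure_labelling d (T : measurableType d) (I : finType) (q : T -> I)
    (mu : {measure set T -> \bar R}) (A : set T) :
  measurable_labelling q -> measurable A ->
  mu A = (\sum_i mu (A `&` q @^-1` [set i]))%E.
Proof.
move=> mq mA.
transitivity (mu (\bigcup_(i in [set: I]) (A `&` q @^-1` [set i]))).
  congr (mu _); apply/seteqP; split=> [x Ax|x [i _ []]//].
  by exists (q x).
rewrite measure_fin_bigcup.
- rewrite [RHS]fsbig_seq ?index_enum_uniq//; apply: eq_fsbigl.
  by apply/seteqP; split=> // i _ /=; rewrite mem_index_enum.
- exact: finite_finset.
- apply/trivIsetP => i j _ _ /eqP ij; rewrite -subset0 => x [[_ /= qi] [_ /= qj]].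
  by apply: ij; rewrite -qi -qj.
- by move=> i _; apply: measurableI => //; exact: mq.
Qed.

Section block_coupling.
Variable X : pointedMetricType R.
Hypothesis cX : compact [set: X].
Implicit Types mu nu : borel_probability R X.

Lemma measurable_rectangle (A B : set (borel X)) :
  measurable A -> measurable B ->
  measurable (fst @^-1` A `&` snd @^-1` B : set (borel (X * X)%type)).
Proof.
move=> mA mB; apply: measurableI; rewrite -[X in measurable X]setTI.
- exact: measurable_fst_borel.
- exact: measurable_snd_borel.
Qed.

(** The product measure, transported from the product sigma-algebra to the Borel
    sigma-algebra of X * X. *)
Lemma independent_coupling mu nu :
  exists P : borel_probability R (X * X)%type, forall A B : set (borel X),
    measurable A -> measurable B ->
    P (fst @^-1` A `&` snd @^-1` B) = (mu A * nu B)%E.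
Proof.
have mid := @measurable_fun_borel_pair R _ (borel X * borel X)%type X fst snd cX
  measurable_fst measurable_snd.
exists (distribution (mu \x nu)%E (mfun_of mid)) => A B mA mB.
by rewrite -product_measure1E.
Qed.

(** In the coupling below, a set of mass a in a cell with row (u j) receives from
    column j the mass u j / (m * n j) * (a * n j), where m is the sum of the row
    and n j the mass of column j; the columns share out exactly a, also when
    some of the denominators vanish. *)
Lemma sum_block_shares (I : finType) (u n : I -> R) (a : R) :
  (forall j, n j = 0 -> u j = 0) -> 0 <= a <= \sum_j u j ->
  \sum_j u j / ((\sum_j u j) * n j) * (a * n j) = a.
Proof.
move=> un0; set m := \sum_j u j => /andP[a0 am].
transitivity (a * (m / m)).
  rewrite mulr_suml mulr_sumr; apply: eq_bigr => j _.
  have [nj0|nj0] := eqVneq (n j) 0; first by rewrite un0// !mul0r mulr0.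
  by rewrite invfM mulrACA [_ * a]mulrC -!mulrA mulVf// mulr1 mulrCA.
have [m0|m0] := eqVneq m 0; last by rewrite divff// mulr1.
by have -> : a = 0; [apply: le_anti; rewrite a0 -m0 am|rewrite mul0r].
Qed.

(** On the block of cells i and j, the coupling is the product measure rescaled
    to have total mass w i j. *)
Lemma coupling_with_block_masses (I : finType) (q : borel X -> I) mu nu
    (w : I -> I -> R) :
  measurable_labelling q -> (forall i j, 0 <= w i j) ->
  (forall i, mu (q @^-1` [set i]) = (\sum_j w i j)%:E) ->
  (forall j, nu (q @^-1` [set j]) = (\sum_i w i j)%:E) ->
  exists2 pi, coupling mu nu pi &
    forall i j, pi (fst @^-1` (q @^-1` [set i]) `&` snd @^-1` (q @^-1` [set j]))
                = (w i j)%:E.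
Proof.
move=> mq w0 muw nuw.
have [P PE] := independent_coupling mu nu.
pose m i := \sum_j w i j; pose n j := \sum_i w i j.
have m0 i : 0 <= m i by exact: sumr_ge0.
have n0 j : 0 <= n j by exact: sumr_ge0.
have wm0 i j : m i = 0 -> w i j = 0.
  by move/eqP; rewrite psumr_eq0// => /allP /(_ j (mem_index_enum _)) /eqP.
have wn0 i j : n j = 0 -> w i j = 0.
  by move/eqP; rewrite psumr_eq0// => /allP /(_ i (mem_index_enum _)) /eqP.
have rho0 k : 0 <= w k.1 k.2 / (m k.1 * n k.2).
  by rewrite divr_ge0// mulr_ge0.
have mC (k : I * I) : measurable (fst @^-1` (q @^-1` [set k.1]) `&`
    snd @^-1` (q @^-1` [set k.2]) : set (borel (X * X)%type)).
  by apply: measurable_rectangle; exact: mq.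
have [pi0 pi0E] := measure_lincomb (index_enum (I * I)%type)
  (fun k => NngNum (rho0 k)) (fun k => mrestr P (mC k)).
have piE (A B : set (borel X)) : measurable A -> measurable B ->
    pi0 (fst @^-1` A `&` snd @^-1` B) =
    (\sum_i \sum_j (w i j / (m i * n j))%:E *
       (mu (A `&` q @^-1` [set i]) * nu (B `&` q @^-1` [set j])))%E.
  move=> mA mB; rewrite pi0E pair_big /=; apply: eq_bigr => -[i j] _ /=.
  congr (_ * _)%E; rewrite /mrestr -PE; [|by apply: measurableI => //; exact: mq..].
  by congr (P _); apply/seteqP; split=> -[x y] /=; tauto.
have marg1 (A : set (borel X)) : measurable A -> pi0 (fst @^-1` A) = mu A.
  move=> mA; rewrite -[_ @^-1` A]setIT -(preimage_setT snd) piE//.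
  rewrite (measure_labelling _ mq mA); apply: eq_bigr => i _.
  have mAi : measurable (A `&` q @^-1` [set i]) by apply: measurableI => //; exact: mq.
  have [a aE] : exists a, mu (A `&` q @^-1` [set i]) = a%:E.
    by exists (fine (mu (A `&` q @^-1` [set i]))); rewrite fineK// fin_num_measure.
  rewrite aE; under eq_bigr => j _ do rewrite setTI [nu _]nuw.
  rewrite sumEFin sum_block_shares//; first by move=> j; exact: wn0.
  rewrite -!lee_fin -aE measure_ge0 -muw.
  by apply: measureIr => //; exact: mq.
have marg2 (B : set (borel X)) : measurable B -> pi0 (snd @^-1` B) = nu B.
  move=> mB; rewrite -[_ @^-1` B]setTI -(preimage_setT fst) piE//.
  rewrite exchange_big (measure_labelling _ mq mB); apply: eq_bigr => j _.
  have mBj : measurable (B `&` q @^-1` [set j]) by apply: measurableI => //; exact: mq.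
  have [b bE] : exists b, nu (B `&` q @^-1` [set j]) = b%:E.
    by exists (fine (nu (B `&` q @^-1` [set j]))); rewrite fineK// fin_num_measure.
  rewrite bE; under eq_bigr => i _.
    rewrite setTI [mu _]muw -/(m i) [m i * n j]mulrC [((m i)%:E * _)%E]muleC. over.
  rewrite sumEFin sum_block_shares//; first by move=> i; exact: wm0.
  rewrite -!lee_fin -bE measure_ge0 -nuw.
  by apply: measureIr => //; exact: mq.
have disj i j : i != j -> q @^-1` [set i] `&` q @^-1` [set j] = set0.
  by move=> /eqP ij; rewrite -subset0 => x [/= qi qj]; apply: ij; rewrite -qi -qj.
have piblock i j : pi0 (fst @^-1` (q @^-1` [set i]) `&` snd @^-1` (q @^-1` [set j])) =
    (w i j)%:E.
  rewrite piE; [|exact: mq..].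
  rewrite (bigD1 i)//= [X in (_ + X)%E]big1 ?adde0; last first.
    move=> k ki; apply: big1 => l _.
    by rewrite disj 1?eq_sym// measure0 mul0e mule0.
  rewrite (bigD1 j)//= [X in (_ + X)%E]big1 ?adde0; last first.
    by move=> l lj; rewrite [X in (_ * nu X)%E]disj 1?eq_sym// measure0 !mule0.
  rewrite !setIid [mu _]muw [nu _]nuw -/(m i) -/(n j).
  have [/wm0 ->|mi0] := eqVneq (m i) 0; first by rewrite mul0r mul0e.
  have [/wn0 ->|nj0] := eqVneq (n j) 0; first by rewrite mul0r mul0e.
  by rewrite -!EFinM divfK// mulf_neq0.
(* The total mass of pi0 is 1: normalizing only changes its type. *)
pose pi : borel_probability R (X * X)%type := mnormalize pi0 P.
have piP A : pi A = pi0 A.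
  have pi01 : pi0 setT = 1%E by rewrite -(preimage_setT fst) marg1// probability_setT.
  by rewrite /pi /= /mnormalize pi01 onee_eq0 /= invr1 mule1.
exists pi; last by move=> i j; rewrite piP.
by move=> A mA; rewrite !piP marg1// marg2.
Qed.

End block_coupling.
End couplings.

(** * Integrals of functions of the label *)

Section labellings.
Context {R : realType} d (T : measurableType d) (I : finType) (q : T -> I).
Hypothesis mq : measurable_labelling q.

Lemma measurable_fun_labelling d' (T' : measurableType d') (g : I -> T') :
  measurable_fun setT (g \o q).
Proof.
move=> _ B mB; rewrite setTI [X in measurable X](_ : _ =
    \bigcup_(i in [set i | B (g i)]) q @^-1` [set i]).
  by apply: fin_bigcup_measurable => // i _; exact: mq.
by apply/seteqP; split=> [x Bx|x [i /= Bi]]; [exists (q x)|move=> /= ->].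
Qed.

Lemma integral_labelling (mu : {measure set T -> \bar R}) (g : I -> R) :
  (forall i, 0 <= g i) ->
  (\int[mu]_x (g (q x))%:E = \sum_i (g i)%:E * mu (q @^-1` [set i]))%E.
Proof.
move=> g0.
transitivity (\int[mu]_x (\sum_i (g i * \1_(q @^-1` [set i]) x)%:E))%E.
  apply: eq_integral => x _; rewrite sumEFin (bigD1 (q x))//= big1.
    by rewrite indicE mem_set// mulr1 addr0.
  by move=> i /eqP qi; rewrite indicE memNset ?mulr0// => /= /esym.
rewrite ge0_integral_sum//.
- apply: eq_bigr => i _; under eq_integral do rewrite EFinM.
  rewrite ge0_integralZl_EFin//; last first.
    by apply/measurable_EFinP; apply: measurable_indic; exact: mq.
  by rewrite integral_indic ?setIT//; exact: mq.
- move=> i; apply/measurable_EFinP; apply: measurable_funM; first by [].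
  by apply: measurable_indic; exact: mq.
- by move=> i x _; rewrite lee_fin mulr_ge0.
Qed.

End labellings.

(** * Bounds on the Wasserstein distance *)

Section Lp_shift.
Context {R : realType} d (T : measurableType d) (P : probability T R).

Lemma integral_probability_cst (r : R) : (\int[P]_x r%:E = r%:E)%E.
Proof.
have PT : (r%:E * P setT = r%:E)%E by rewrite probability_setT mule1.
by rewrite -[LHS]/(\int[P]_x (cst r%:E x))%E integral_cst.
Qed.

(** Minkowski's inequality for f and a constant function, on a probability
    space. *)
Lemma integral_powR_shift (f : T -> R) (h r p : R) :
  1 <= p -> 0 <= h -> 0 <= r -> measurable_fun setT f -> (forall x, 0 <= f x) ->
  (\int[P]_x (f x `^ p)%:E <= (r `^ p)%:E)%E ->
  (\int[P]_x ((f x + h) `^ p)%:E <= ((r + h) `^ p)%:E)%E.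
Proof.
move=> p1 h0 r0 mf f0 fr.
have p0 : 0 < p by exact: lt_le_trans p1.
have pN0 : p != 0 by rewrite gt_eqF.
have intE (g : T -> R) : (forall x, 0 <= g x) ->
    ('N[P]_p%:E[EFin \o g] `^ p = \int[P]_x (g x `^ p)%:E)%E.
  move=> g0; rewrite (powR_Lnorm _ _ pN0); apply: eq_integral => x _ /=.
  by rewrite ger0_norm.
have Nle (g : T -> R) s : (forall x, 0 <= g x) -> 0 <= s ->
    (\int[P]_x (g x `^ p)%:E <= (s `^ p)%:E)%E -> ('N[P]_p%:E[EFin \o g] <= s%:E)%E.
  move=> g0 s0; rewrite -intE// => gs.
  have -> : ('N[P]_p%:E[EFin \o g] = ('N[P]_p%:E[EFin \o g] `^ p) `^ p^-1)%E.
    by rewrite -poweRrM mulfV ?pN0 ?poweRe1 ?Lnorm_ge0.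
  have -> : s%:E = ((s `^ p)%:E `^ p^-1)%E.
    by rewrite poweR_EFin -powRrM mulfV// powRr1.
  apply: gt0_ler_poweR => //; first by rewrite invr_ge0 ltW.
  - by rewrite in_itv /= leey poweR_ge0.
  - by rewrite in_itv /= leey lee_fin powR_ge0.
rewrite -(intE (f \+ cst h)); last by move=> x /=; rewrite addr_ge0.
have Nh : ('N[P]_p%:E[EFin \o cst h] <= h%:E)%E.
  apply: Nle => //; rewrite -[leLHS]/(\int[P]_x (h `^ p)%:E)%E.
  by rewrite integral_probability_cst.
rewrite -poweR_EFin gt0_ler_poweR//.
- by rewrite ltW.
- by rewrite in_itv /= leey Lnorm_ge0.
- by rewrite in_itv /= leey lee_fin addr_ge0.
apply: le_trans (minkowski_EFin _ _ _ p1) _ => //.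
by rewrite EFinD leeD// Nle.
Qed.

End Lp_shift.

Section wasserstein_bounds.
Context {R : realType} (p : R).
Hypothesis p_ge1 : 1 <= p.
Implicit Types X Y : pointedMetricType R.

Let p_gt0 : 0 < p. Proof. exact: lt_le_trans p_ge1. Qed.

Lemma powRrK (r : R) : 0 <= r -> (r `^ p) `^ p^-1 = r.
Proof. by move=> r0; rewrite -powRrM mulfV ?gt_eqF// powRr1. Qed.

Lemma powRVrK (r : R) : 0 <= r -> (r `^ p^-1) `^ p = r.
Proof. by move=> r0; rewrite -powRrM mulVf ?gt_eqF// powRr1. Qed.

Lemma measurable_mdist_powR X :
  measurable_fun setT (fun z : borel (X * X)%type => (mdist z.1 z.2 `^ p)%:E).
Proof.
apply/measurable_EFinP.
apply: (@measurableT_comp _ _ _ _ _ _ (@powR R ^~ p)) => //.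
exact: measurable_mdist.
Qed.

Definition cost X (pi : borel_probability R (X * X)%type) : \bar R :=
  (\int[pi]_z (mdist z.1 z.2 `^ p)%:E)%E.

Lemma cost_ge0 X (pi : borel_probability R (X * X)%type) : (0 <= cost pi)%E.
Proof. by apply: integral_ge0 => z _; rewrite lee_fin powR_ge0. Qed.

Lemma wasserstein_le_cost X (mu nu : borel_probability R X) pi (r : R) :
  coupling mu nu pi -> 0 <= r -> (cost pi <= (r `^ p)%:E)%E ->
  wasserstein p mu nu <= r.
Proof.
move=> cpi r0 cr; rewrite -[leRHS](powRrK r0) /wasserstein.
set W := ereal_inf _.
have W0 : (0 <= W)%E.
  by apply: le_ereal_inf_tmp => _ [pi' _ <-]; exact: cost_ge0.
have Wr : (W <= (r `^ p)%:E)%E by apply: ge_ereal_inf; exists (cost pi) => //; exists pi.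
apply: ge0_ler_powR; rewrite ?nnegrE ?invr_ge0 ?(ltW p_gt0) ?fine_ge0 ?powR_ge0//.
by rewrite -lee_fin fineK// ge0_fin_numE// (le_lt_trans Wr)// ltry.
Qed.

Lemma cost_le X (pi : borel_probability R (X * X)%type) (r : R) :
  0 <= r -> (forall x y : X, mdist x y <= r) -> (cost pi <= (r `^ p)%:E)%E.
Proof.
move=> r0 dr; apply: (@le_trans _ _ (\int[pi]_z (r `^ p)%:E)%E).
  apply: ge0_le_integral => //.
  - by move=> z _; rewrite lee_fin powR_ge0.
  - exact: measurable_mdist_powR.
  - by move=> z _; rewrite lee_fin ge0_ler_powR ?nnegrE ?mdist_ge0 ?(ltW p_gt0).
by rewrite integral_probability_cst.
Qed.

(** Compactness makes the infimum of the costs a real number, which is not lost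
    when fine is applied to it: the product coupling has finite cost. *)
Lemma coupling_of_wasserstein_lt X (mu nu : borel_probability R X) (r : R) :
  compact [set: X] -> wasserstein p mu nu < r ->
  exists2 pi, coupling mu nu pi & (cost pi < (r `^ p)%:E)%E.
Proof.
move=> cX; rewrite /wasserstein; set W := ereal_inf _ => Wr.
have W0 : (0 <= W)%E.
  by apply: le_ereal_inf_tmp => _ [pi' _ <-]; exact: cost_ge0.
have [P PE] := independent_coupling cX mu nu.
have cP : coupling mu nu P.
  move=> A mA; split.
  - by rewrite -[_ @^-1` A]setIT -(preimage_setT snd) PE// probability_setT mule1.
  - by rewrite -[_ @^-1` A]setTI -(preimage_setT fst) PE// probability_setT mul1e.
have [D D0 dD] := mdist_bounded cX.
have Wfin : W \is a fin_num.
  rewrite ge0_fin_numE//; apply: (@le_lt_trans _ _ (cost P)).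
    by apply: ge_ereal_inf; exists (cost P) => //; exists P.
  by apply: le_lt_trans (cost_le P (ltW D0) dD) _; rewrite ltry.
have [_ [pi cpi <-] pir] : exists2 c, [set cost pi | pi in coupling mu nu] c &
    (c < (r `^ p)%:E)%E.
  apply: ereal_inf_lt; rewrite -/W -(fineK Wfin) lte_fin.
  rewrite -[ltLHS](powRVrK (fine_ge0 W0)) gt0_ltr_powR// ?nnegrE ?powR_ge0//.
  by rewrite (le_trans _ (ltW Wr)) ?powR_ge0.
by exists pi.
Qed.

End wasserstein_bounds.

(** * Transfer of couplings along partitions *)

Section transfer.
Context {R : realType} (p : R).
Hypothesis p_ge1 : 1 <= p.
Implicit Types X Y : pointedMetricType R.

Let p_gt0 : 0 < p. Proof. exact: lt_le_trans p_ge1. Qed.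

Definition pair_label (T I : Type) (q : T -> I) (z : T * T) : I * I :=
  (q z.1, q z.2).

Lemma pair_label_preimage (T I : Type) (q : T -> I) (ij : I * I) :
  pair_label q @^-1` [set ij] =
  fst @^-1` (q @^-1` [set ij.1]) `&` snd @^-1` (q @^-1` [set ij.2]).
Proof.
by case: ij => i j; apply/seteqP; split=> z; rewrite /pair_label /= => -[-> ->].
Qed.

Lemma measurable_pair_label X (I : Type) (q : borel X -> I) :
  measurable_labelling q ->
  measurable_labelling (pair_label q : borel (X * X)%type -> I * I).
Proof.
by move=> mq ij; rewrite pair_label_preimage; apply: measurable_rectangle; exact: mq.
Qed.

Lemma coupling_blocks X (I : finType) (q : borel X -> I)
    (mu nu : borel_probability R X) pi :
  measurable_labelling q -> coupling mu nu pi ->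
  (forall i, mu (q @^-1` [set i]) =
     \sum_j pi (pair_label q @^-1` [set (i, j)]))%E /\
  (forall j, nu (q @^-1` [set j]) =
     \sum_i pi (pair_label q @^-1` [set (i, j)]))%E.
Proof.
move=> mq cpi; have mT := @measurableT _ (borel X).
have mfst i : measurable (fst @^-1` (q @^-1` [set i]) : set (borel (X * X)%type)).
  by rewrite -[_ @^-1` _]setIT -(preimage_setT snd); apply: measurable_rectangle.
have msnd i : measurable (snd @^-1` (q @^-1` [set i]) : set (borel (X * X)%type)).
  by rewrite -[_ @^-1` _]setTI -(preimage_setT fst); apply: measurable_rectangle.
split=> k.
- rewrite -(cpi _ (mq k)).1.
  rewrite (@measure_labelling _ _ _ _ (q \o snd : borel (X * X)%type -> I) pi)//.
  by apply: eq_bigr => j _; rewrite pair_label_preimage.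
- rewrite -(cpi _ (mq k)).2.
  rewrite (@measure_labelling _ _ _ _ (q \o fst : borel (X * X)%type -> I) pi)//.
  by apply: eq_bigr => i _; rewrite pair_label_preimage setIC.
Qed.

Lemma cost_le_blocks X (I : finType) (q : borel X -> I)
    (g : I * I -> R) (pi : borel_probability R (X * X)%type) :
  measurable_labelling q -> (forall ij, 0 <= g ij) ->
  (forall x y : X, mdist x y <= g (q x, q y)) ->
  (cost p pi <= \sum_ij (g ij `^ p)%:E * pi (pair_label q @^-1` [set ij]))%E.
Proof.
move=> mq g0 dg; have mqq := measurable_pair_label mq.
rewrite -(@integral_labelling _ _ _ _ _ mqq pi (fun ij => g ij `^ p)); last first.
  by move=> ij; exact: powR_ge0.
apply: ge0_le_integral => //.
- by move=> z _; rewrite lee_fin powR_ge0.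
- exact: measurable_mdist_powR.
- apply/measurable_EFinP.
  exact: (@measurable_fun_labelling _ _ _ _ mqq _ _ (fun ij => g ij `^ p)).
- by move=> z _; rewrite lee_fin ge0_ler_powR ?nnegrE ?mdist_ge0 ?(ltW p_gt0)// dg.
Qed.

(** The two spaces communicate only through the index set I of their partitions:
    a nearly optimal coupling of mu and nu yields a matrix of block masses, and
    a coupling of mu' and nu' with the same matrix costs at most the sum, over
    the blocks, of their masses times the p-th power of the largest distance in
    the block of Y. That distance is at most h more than any distance in the
    matching block of X. *)
Lemma wasserstein_transfer X Y (I : finType) (k : borel X -> I)
    (l : borel Y -> I) (h : R) (mu nu : borel_probability R X)
    (mu' nu' : borel_probability R Y) :
  compact [set: X] -> compact [set: Y] ->
  measurable_labelling k -> measurable_labelling l -> 0 <= h ->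
  (forall i, mu (k @^-1` [set i]) = mu' (l @^-1` [set i])) ->
  (forall i, nu (k @^-1` [set i]) = nu' (l @^-1` [set i])) ->
  (forall (x x' : X) (y y' : Y), k x = l y -> k x' = l y' ->
     mdist y y' <= mdist x x' + h) ->
  wasserstein p mu' nu' <= wasserstein p mu nu + h.
Proof.
move=> cX cY mk ml h0 muE nuE dXY.
apply/ler_addgt0Pr => e e0; rewrite addrAC.
set r := _ + e.
have W0 : 0 <= wasserstein p mu nu by exact: powR_ge0.
have r0 : 0 <= r by rewrite addr_ge0// ltW.
have [pi cpi /ltW pir] : exists2 pi, coupling mu nu pi & (cost p pi < (r `^ p)%:E)%E.
  by apply: coupling_of_wasserstein_lt => //; rewrite ltrDl.
have mkk := measurable_pair_label mk.
have mll := measurable_pair_label ml.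
pose w i j := fine (pi (pair_label k @^-1` [set (i, j)])).
have wE i j : pi (pair_label k @^-1` [set (i, j)]) = (w i j)%:E.
  by rewrite /w fineK// fin_num_measure.
have w0 i j : 0 <= w i j by rewrite -lee_fin -wE.
have [piX piY] := coupling_blocks mk cpi.
have [||pi' cpi' pi'E] := @coupling_with_block_masses R Y cY I l mu' nu' w ml w0.
- by move=> i; rewrite -muE piX -sumEFin; apply: eq_bigr => j _; rewrite wE.
- by move=> j; rewrite -nuE piY -sumEFin; apply: eq_bigr => i _; rewrite wE.
(* The distances realized in a block of Y; their supremum is the cost of the
   block, and is 0 when a cell is empty. *)
pose D (ij : I * I) := [set mdist z.1 z.2 | z in pair_label l @^-1` [set ij]].
have [C C0 dC] := mdist_bounded cY.
have Dub ij : has_ubound (D ij) by exists C => _ [z _ <-]; exact: dC.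
have supD y y' : mdist y y' <= sup (D (l y, l y')).
  by apply: ub_le_sup => //; exists (y, y').
have supD0 ij : 0 <= sup (D ij).
  have [->|/set0P [r' [z zij zr]]] := eqVneq (D ij) set0; first by rewrite sup0.
  by rewrite (le_trans (mdist_ge0 z.1 z.2))// ub_le_sup//; exists z.
have supDle x x' : sup (D (k x, k x')) <= mdist x x' + h.
  have [->|/set0P D0] := eqVneq (D (k x, k x')) set0.
    by rewrite sup0 addr_ge0 ?mdist_ge0.
  by apply: ge_sup => // _ [[y y'] [/= ly ly'] <-]; exact: dXY.
apply: (wasserstein_le_cost p_ge1 cpi'); first by rewrite addr_ge0.
apply: le_trans (@cost_le_blocks Y I l (fun ij => sup (D ij)) pi' ml supD0 supD) _.
apply: le_trans (integral_powR_shift p_ge1 h0 r0 (@measurable_mdist _ X)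
  (fun z => mdist_ge0 z.1 z.2) pir).
rewrite [leLHS](_ : _ = \int[pi]_z (sup (D (pair_label k z)) `^ p)%:E)%E; last first.
  rewrite (@integral_labelling _ _ _ _ _ mkk pi (fun ij => sup (D ij) `^ p)); last first.
    by move=> ij; exact: powR_ge0.
  apply: eq_bigr => -[i j] _; congr (_ * _)%E.
  transitivity (w i j)%:E; last exact/esym/wE.
  by rewrite pair_label_preimage; exact: pi'E.
apply: ge0_le_integral => //.
- by move=> z _; rewrite lee_fin powR_ge0.
- apply/measurable_EFinP.
  exact: (@measurable_fun_labelling _ _ _ _ mkk _ _ (fun ij => sup (D ij) `^ p)).
- apply/measurable_EFinP.
  apply: (@measurableT_comp _ _ _ _ _ _ (@powR R ^~ p)) => //.
  by apply: measurable_funD => //; exact: measurable_mdist.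
- move=> z _; rewrite lee_fin ge0_ler_powR ?nnegrE ?addr_ge0 ?mdist_ge0 ?(ltW p_gt0)//.
  exact: supDle.
Qed.

(** The cost of the coupling (u, v)_*P is the integral of mdist (u z) (v z) to
    the power p. *)
Lemma wasserstein_distribution_le d (Z : measurableType d) X (P : probability Z R)
    (u v : {mfun Z >-> borel X}) (h : R) :
  compact [set: X] -> 0 <= h -> (forall z, mdist (u z : X) (v z) <= h) ->
  wasserstein p (distribution P u) (distribution P v) <= h.
Proof.
move=> cX h0 duv.
have mf := @measurable_fun_borel_pair R _ Z X u v cX
  (@measurable_funPT _ _ _ _ u) (@measurable_funPT _ _ _ _ v).
pose pi : borel_probability R (X * X)%type := distribution P (mfun_of mf).
apply: (@wasserstein_le_cost R p p_ge1 X _ _ pi) => //.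
rewrite /cost /pi /distribution ge0_integral_pushforward//; last 2 first.
- exact: measurable_mdist_powR.
- by move=> z _; rewrite lee_fin powR_ge0.
rewrite preimage_setT -[leRHS](integral_probability_cst P).
apply: ge0_le_integral => //.
- by move=> z _; rewrite lee_fin powR_ge0.
- apply: (@measurableT_comp _ _ _ _ _ _ _ _ _ _ mf).
  exact: measurable_mdist_powR.
- move=> z _; rewrite lee_fin /= ge0_ler_powR ?nnegrE ?mdist_ge0 ?(ltW p_gt0)//.
Qed.

End transfer.

(** * Masses of Borel sets as Borel functions of the measure *)

Section evaluation.
Context {R : realType} (p : R).
Hypothesis p_ge1 : 1 <= p.
Variable X : pointedMetricType R.
Hypothesis cX : compact [set: X].

Let p_gt0 : 0 < p. Proof. exact: lt_le_trans p_ge1. Qed.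

(** Markov's inequality: a cheap coupling moves little mass far. *)
Lemma coupling_far_mass_lt (mu nu : borel_probability R X) (r s : R) :
  0 < r -> 0 < s -> wasserstein p mu nu < r * s `^ p^-1 ->
  exists2 pi, coupling mu nu pi &
    (pi [set z | (r <= mdist z.1 z.2)%R] < s%:E)%E.
Proof.
move=> r0 s0 /(coupling_of_wasserstein_lt p_ge1 cX)[pi cpi].
rewrite powRM ?powR_ge0 ?(ltW r0)// powRVrK ?(ltW s0)// => costs.
exists pi => //; set B := [set z | _].
have mB := @measurable_mdist_ge R X r : measurable (B : set (borel (X * X)%type)).
have rp0 : 0 < r `^ p by rewrite powR_gt0.
suff : ((r `^ p)%:E * pi B <= cost p pi)%E.
  move=> /le_lt_trans /(_ costs); rewrite EFinM lte_pmul2l ?lte_fin//.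
have mB1 : measurable_fun setT (\1_B : borel (X * X)%type -> R).
  exact: measurable_indic.
have -> : ((r `^ p)%:E * pi B = \int[pi]_z (r `^ p * \1_B z)%:E)%E.
  under eq_integral do rewrite EFinM.
  rewrite ge0_integralZl_EFin ?powR_ge0//; last exact/measurable_EFinP.
  by rewrite integral_indic// setIT.
apply: ge0_le_integral => //.
- by move=> z _; rewrite lee_fin mulr_ge0 ?powR_ge0.
- by apply/measurable_EFinP/measurable_funM.
- exact: measurable_mdist_powR.
- move=> z _; rewrite lee_fin indicE; have [/set_mem /= zB|_] := boolP (z \in B).
    by rewrite mulr1 ge0_ler_powR ?nnegrE ?mdist_ge0 ?(ltW p_gt0) ?(ltW r0).
  by rewrite mulr0 powR_ge0.
Qed.

(** Lower semicontinuity of mu |-> mu U. The points of U whose ball of radius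
    1/(n+1) stays in U form a set V n that already has mass more than t for n
    large; a coupling of mu and nu brings V n into U, except for the mass that it
    moves by 1/(n+1) or more. *)
Lemma dist_open_evaluation_gt (U : set X) (t : R) : open U ->
  dist_open (wasserstein p)
    [set mu : borel_probability R X | (t%:E < mu (U : set (borel X)))%E].
Proof.
move=> oU mu /= tU.
pose V n := [set x : X | forall y, mdist x y < n.+1%:R^-1 -> U y].
have mV n : measurable (V n : set (borel X)).
  rewrite -[V n]setCK; apply: measurableC; apply: open_measurable_borel.
  rewrite (_ : ~` _ = \bigcup_(y in ~` U) [set x | mdist y x < n.+1%:R^-1]).
    by apply: bigcup_open => y _; exact: open_mdist_lt.
  apply/seteqP; split=> [x /= /existsNP[y /not_implyP[xy Uy]]|x [y Uy /= xy]].
    by exists y => //=; rewrite metric_sym.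
  by move=> /(_ y); rewrite metric_sym => /(_ xy).
have VU n : V n `<=` U by move=> x; apply; rewrite mdistxx.
have UV : \bigcup_n V n = U.
  apply/seteqP; split=> [x [n _ /VU]//|x Ux].
  have : dist_open mdist U by rewrite dist_open_mdist.
  move=> /(_ x Ux)[e e0 eU].
  have := @ltr_add_invr R 0 e e0 => -[n]; rewrite add0r => ne.
  by exists n => // y xy; apply: eU => /=; exact: lt_trans ne.
have ndV : {homo V : n m / (n <= m)%N >-> (n <= m)%O}.
  move=> n m nm; apply/subsetPset => x Vx y xy; apply: Vx.
  by rewrite (lt_le_trans xy)// lef_pV2 ?posrE// ler_nat.
have [n tVn] : exists n, (t%:E < mu (V n : set (borel X)))%E.
  apply: contrapT => /forallNP Vt.
  have := @nondecreasing_cvg_mu _ _ _ mu V mV.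
  rewrite UV => /(_ (open_measurable_borel oU) ndV) muV.
  have : (mu (U : set (borel X)) <= t%:E)%E.
    apply: cvge_le muV; apply: nearW => n /=.
    by rewrite leNgt; apply/negP/Vt.
  by rewrite leNgt tU.
have [v vE] : exists v, mu (V n : set (borel X)) = v%:E.
  by exists (fine (mu (V n : set (borel X)))); rewrite fineK// fin_num_measure.
pose s := v - t; have s0 : 0 < s by rewrite subr_gt0 -lte_fin -vE.
exists (n.+1%:R^-1 * s `^ p^-1) => [|nu /= Wnu].
  by rewrite mulr_gt0 ?powR_gt0.
have [|pi cpi far] := coupling_far_mass_lt _ s0 Wnu; first by [].
set B := [set z | _] in far.
have mB := @measurable_mdist_ge R X n.+1%:R^-1 :
  measurable (B : set (borel (X * X)%type)).
have mU := open_measurable_borel oU.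
have msU : measurable (snd @^-1` U : set (borel (X * X)%type)).
  by rewrite -[X in measurable X]setTI; exact: measurable_snd_borel.
have mfV : measurable (fst @^-1` V n : set (borel (X * X)%type)).
  by rewrite -[X in measurable X]setTI; exact: measurable_fst_borel.
have : (v%:E <= nu (U : set (borel X)) + pi B)%E.
  rewrite -vE -(cpi _ (mV n)).1 -(cpi _ mU).2.
  apply: le_trans (measureU2 pi msU mB); apply: le_measure; first exact/mem_set.
    by apply/mem_set; exact: measurableU.
  move=> z /= Vz; have [zn|zn] := ltP (mdist z.1 z.2) n.+1%:R^-1.
    by left; exact: Vz.
  by right.
have [b bE] : exists b, pi B = b%:E.
  by exists (fine (pi B)); rewrite fineK// fin_num_measure.
have [u uE] : exists u, nu (U : set (borel X)) = u%:E.
  by exists (fine (nu (U : set (borel X)))); rewrite fineK// fin_num_measure.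
move: far; rewrite uE bE -EFinD lee_fin !lte_fin /s; lra.
Qed.

Definition wasserstein_borel :=
  g_sigma_algebraType (dist_open (@wasserstein R X p)).

(** The sets A with this property form a lambda-system which contains the open
    sets. *)
Lemma measurable_evaluation (A : set (borel X)) : measurable A ->
  measurable_fun setT (fun mu : wasserstein_borel => mu A).
Proof.
move: A; apply: (@dynkin_induction _ (borel X) open) => //.
- by move=> U V oU oV; exact: openI.
- by under eq_fun do rewrite probability_setT; exact: measurable_cst.
- move=> U oU; apply: (measurability _ (ErealGenOInfty.measurableE R)).
  move=> _ [_ [t ->] <-]; rewrite setTI; apply: sub_sigma_algebra.
  rewrite [X in dist_open _ X](_ : _ =
      [set mu : borel_probability R X | (t%:E < mu (U : set (borel X)))%E]).
    exact: dist_open_evaluation_gt.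
  by apply/seteqP; split=> mu /=; rewrite in_itv /= andbT.
- move=> A mA mevA; under eq_fun do rewrite probability_setC//.
  by apply: emeasurable_funB.
- move=> F mF tF mevF.
  rewrite (_ : (fun _ => _) = fun mu : wasserstein_borel =>
      (\sum_(0 <= n <oo) (mu : borel_probability R X) (F n))%E).
    by apply: ge0_emeasurable_sum => // n mu _ _.
  apply/funext => mu; rewrite measure_bigcup//.
  by apply: eq_eseriesl => n; rewrite in_setT.
Qed.

End evaluation.

(** * Borel measurability of push-forward *)

Section push_forward_borel.
Context {R : realType} (p : R).
Hypothesis p_ge1 : 1 <= p.
Implicit Types X Y : pointedMetricType R.

Let p_gt0 : 0 < p. Proof. exact: lt_le_trans p_ge1. Qed.

(** With a i and b i the masses of cell i under mu and nu, the common part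
    m i = min (a i) (b i) stays in its cell, at distance at most e/4, and what
    remains, of total mass t <= N s, is coupled as a product, at distance at most
    a bound D of the diameter. The p-th power of the distance between mu and nu is thus at
    most (e/4)^p + N s D^p, and s is chosen so that this is at most (e/2)^p. *)
Lemma wasserstein_lt_close_masses X (e : R) : compact [set: X] -> 0 < e ->
  exists N (q : borel X -> 'I_N) (s : R),
    [/\ measurable_labelling q, 0 < s &
      forall mu nu : borel_probability R X,
        (forall i, `|fine (mu (q @^-1` [set i])) - fine (nu (q @^-1` [set i]))| <= s) ->
        wasserstein p mu nu < e].
Proof.
move=> cX e0.
have [D [D0 eD dD]] : exists D : R,
    [/\ 0 < D, e / 4 <= D & forall x y : X, mdist x y <= D].
  have [D D0 dD] := mdist_bounded cX; exists (D + e); split; [lra|lra|].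
  by move=> x y; have := dD x y; lra.
have e40 : 0 < e / 4 by rewrite divr_gt0.
have [N [q [mq dq]]] := fine_labelling cX e40.
have Dp0 : 0 < D `^ p by rewrite powR_gt0.
have gap : 0 < (e / 2) `^ p - (e / 4) `^ p.
  by rewrite subr_gt0 gt0_ltr_powR ?nnegrE//; lra.
pose s := ((e / 2) `^ p - (e / 4) `^ p) / (N.+1%:R * D `^ p).
exists N, q, s; split=> // [|mu nu munu]; first by rewrite divr_gt0// mulr_gt0.
pose a i := fine (mu (q @^-1` [set i])); pose b i := fine (nu (q @^-1` [set i])).
have aE i : mu (q @^-1` [set i]) = (a i)%:E by rewrite fineK// fin_num_measure.
have bE i : nu (q @^-1` [set i]) = (b i)%:E by rewrite fineK// fin_num_measure.
have sum1 (P : borel_probability R X) (c : 'I_N -> R) :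
    (forall i, P (q @^-1` [set i]) = (c i)%:E) -> \sum_i c i = 1.
  move=> PE; apply: EFin_inj; rewrite -sumEFin -(probability_setT P).
  rewrite (measure_labelling P mq measurableT).
  by apply: eq_bigr => i _; rewrite setTI; exact/esym/PE.
have a1 := sum1 _ _ aE; have b1 := sum1 _ _ bE.
pose m i := Num.min (a i) (b i).
have m0 i : 0 <= m i by rewrite le_min !fine_ge0.
have ma i : 0 <= a i - m i by rewrite subr_ge0 ge_min lexx.
have mb i : 0 <= b i - m i by rewrite subr_ge0 ge_min lexx orbT.
pose t := \sum_i (a i - m i).
have tE : t = \sum_i (b i - m i) by rewrite /t !sumrB a1 b1.
have t0 : 0 <= t by exact: sumr_ge0.
have tNs : t <= N%:R * s.
  rewrite /t mulr_natl -[N in leRHS]card_ord -sumr_const; apply: ler_sum => i _.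
  by have := munu i; rewrite -/(a i) -/(b i) /m ler_norml; case: (leP (a i) (b i)); lra.
pose w i j := (if i == j then m i else 0) + (a i - m i) * (b j - m j) / t.
have w0 i j : 0 <= w i j.
  by rewrite addr_ge0//; [case: ifP|rewrite divr_ge0// mulr_ge0].
(* Division by t is harmless: if t = 0 then so are all the remainders. *)
have divK (c : 'I_N -> R) i : (forall j, 0 <= c j) -> t = \sum_j c j -> c i * t / t = c i.
  move=> c0 tc; have [t00|tN0] := eqVneq t 0; last by rewrite mulfK.
  have := t00; rewrite tc => /eqP; rewrite psumr_eq0// => /allP /(_ i (mem_index_enum _)).
  by move=> /eqP ->; rewrite !mul0r.
have rows i : \sum_j w i j = a i.
  rewrite big_split /= -big_mkcond /= (big_pred1 i); last by move=> j; rewrite eq_sym.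
  rewrite -mulr_suml -mulr_sumr -tE (divK (fun i => a i - m i))//; lra.
have cols j : \sum_i w i j = b j.
  rewrite big_split /= -big_mkcond /= (big_pred1 j)//.
  rewrite -mulr_suml -mulr_suml -/t [t * _]mulrC (divK (fun j => b j - m j))//; lra.
have [||pi cpi piE] := @coupling_with_block_masses R X cX 'I_N q mu nu w mq w0.
- by move=> i; rewrite rows aE.
- by move=> j; rewrite cols bE.
apply: (@le_lt_trans _ _ (e / 2)); last by lra.
apply: (wasserstein_le_cost p_ge1 cpi); first by lra.
pose g (ij : 'I_N * 'I_N) := if ij.1 == ij.2 then e / 4 else D.
apply: le_trans (@cost_le_blocks R p p_ge1 X 'I_N q g pi mq _ _) _.
- by move=> ij; rewrite /g; case: ifP => _; lra.
- by move=> x y; rewrite /g /=; case: eqP => [/dq|_].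
have -> : (\sum_ij (g ij `^ p)%:E * pi (pair_label q @^-1` [set ij]) =
    (\sum_i \sum_j g (i, j) `^ p * w i j)%:E)%E.
  rewrite pair_big /= -sumEFin; apply: eq_bigr => -[i j] _.
  by rewrite pair_label_preimage piE EFinM.
rewrite lee_fin.
apply: (@le_trans _ _ (\sum_i \sum_j ((if i == j then (e / 4) `^ p * m i else 0)
    + D `^ p * ((a i - m i) * (b j - m j) / t)))).
  apply: ler_sum => i _; apply: ler_sum => j _; rewrite /g /w /=.
  have x0 : 0 <= (a i - m i) * (b j - m j) / t by rewrite divr_ge0// mulr_ge0.
  have eDp : (e / 4) `^ p <= D `^ p.
    by rewrite ge0_ler_powR ?nnegrE ?(ltW p_gt0) ?(ltW e40) ?(ltW D0).
  by case: eqP => _; rewrite mulrDr ?mulr0 ?add0r// lerD2l ler_wpM2r.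
under eq_bigr => i _.
  rewrite big_split /= -big_mkcond /= (big_pred1 i); last by move=> j; rewrite eq_sym.
  rewrite -mulr_sumr -mulr_suml -mulr_sumr -tE (divK (fun i => a i - m i))//.
  over.
rewrite big_split /= -!mulr_sumr -/t.
have m1 : \sum_i m i <= 1 by rewrite -a1; apply: ler_sum => i _; rewrite ge_min lexx.
have Dt : D `^ p * t <= (e / 2) `^ p - (e / 4) `^ p.
  apply: (@le_trans _ _ (D `^ p * (N.+1%:R * s))).
    rewrite ler_pM2l//; apply: le_trans tNs _.
    by rewrite ler_wpM2r ?ler_nat// divr_ge0 ?(ltW gap)// ltW// mulr_gt0.
  by rewrite mulrA [D `^ p * _]mulrC [X in X <= _]mulrC divfK// gt_eqF// mulr_gt0.
have em : (e / 4) `^ p * \sum_i m i <= (e / 4) `^ p by rewrite ler_piMr ?powR_ge0.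
lra.
Qed.

(** Rounding the masses of the cells of a fine partition of Y, cut into steps of
    length s, partitions P_p(Y) into countably many sets of small diameter. An
    open set is the union of those of these sets, for finer and finer partitions,
    that it contains; membership in each is a condition on finitely many masses,
    hence so is membership of the push-forward, with the preimages of the cells
    in place of the cells. *)
Lemma borel_map_distribution X Y (f : {mfun borel X >-> borel Y}) :
  compact [set: X] -> compact [set: Y] ->
  borel_map (@wasserstein R X p) (@wasserstein R Y p)
    (fun mu : borel_probability R X => distribution mu f : borel_probability R Y).
Proof.
move=> cX cY.
pose F (mu : wasserstein_borel p X) : wasserstein_borel p Y :=
  (distribution (mu : borel_probability R X) f : borel_probability R Y).
suff mF : measurable_fun setT F.
  by move=> B mB; have := mF measurableT B mB; rewrite setTI.
apply: (@measurability _ _ _ (wasserstein_borel p Y) _ _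
  (dist_open (wasserstein p))) => //.
move=> _ [U oU <-]; rewrite setTI.
have labn n : {N : nat & {q : borel Y -> 'I_N & {s : R |
    [/\ measurable_labelling q, 0 < s &
      forall mu nu : borel_probability R Y,
        (forall i, `|fine (mu (q @^-1` [set i])) - fine (nu (q @^-1` [set i]))| <= s) ->
        wasserstein p mu nu < n.+1%:R^-1]}}}.
  have [N /cid[q qP]] := cid (@wasserstein_lt_close_masses Y n.+1%:R^-1 cY ltac:(by [])).
  by exists N, q; exact: cid.
pose N n := projT1 (labn n).
pose q n : borel Y -> 'I_(N n) := projT1 (projT2 (labn n)).
pose s n := sval (projT2 (projT2 (labn n))).
have mq n : measurable_labelling (q n) by have [] := svalP (projT2 (projT2 (labn n))).
have s0 n : 0 < s n by have [] := svalP (projT2 (projT2 (labn n))).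
have Wq n (mu nu : borel_probability R Y) : (forall i,
    `|fine (mu (q n @^-1` [set i])) - fine (nu (q n @^-1` [set i]))| <= s n) ->
    wasserstein p mu nu < n.+1%:R^-1.
  by have [_ _] := svalP (projT2 (projT2 (labn n))); apply.
pose cell n (k : {ffun 'I_(N n) -> nat}) : set (borel_probability R Y) :=
  [set nu | forall i, fine (nu (q n @^-1` [set i])) \in
     `[(k i)%:R * s n, (k i).+1%:R * s n[ ].
have cell_lt n k mu nu : cell n k mu -> cell n k nu -> wasserstein p mu nu < n.+1%:R^-1.
  move=> ck ck'; apply: Wq => i; have := ck i; have := ck' i.
  rewrite !in_itv /= -natr1 mulrDl mul1r ler_norml.
  move: (fine _) (fine _) (_ * s n) => x y z; lra.
pose inside n := [set k | cell n k `<=` U].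
have -> : F @^-1` U = \bigcup_n \bigcup_(k in inside n) (F @^-1` cell n k).
  apply/seteqP; split=> [mu Umu|mu [n _ [k kU]]]; last exact: kU.
  have [e e0 eU] := oU _ Umu.
  have := @ltr_add_invr R 0 e e0 => -[n]; rewrite add0r => ne.
  pose k := [ffun i => Num.truncn
    (fine ((F mu : borel_probability R Y) (q n @^-1` [set i])) / s n)].
  have ck : cell n k (F mu).
    move=> i; rewrite in_itv /= ffunE -ler_pdivlMr// -ltr_pdivrMr//.
    apply: truncn_itv; apply: divr_ge0; last exact: ltW.
    exact/fine_ge0/measure_ge0.
  exists n => //; exists k => // nu cnu; apply: eU => /=.
  exact: lt_trans (cell_lt _ _ _ _ ck cnu) ne.
apply: bigcupT_measurable => n.
rewrite (_ : \bigcup_(k in _) _ = \bigcup_k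
    (if pselect (inside n k) then F @^-1` cell n k else set0)); last first.
  apply/seteqP; split=> mu [k].
    by move=> kU ck; exists k => //; case: pselect.
  by move=> _; case: pselect => // kU ck; exists k.
apply: countable_bigcupT_measurable => [|k]; first exact: countableP.
case: pselect => [kU|kU] /=; last exact: measurable0.
rewrite (_ : F @^-1` _ = \bigcap_(i in [set: 'I_(N n)])
  ((fun mu : wasserstein_borel p X =>
     fine ((mu : borel_probability R X) (f @^-1` (q n @^-1` [set i])))) @^-1`
     [set` `[(k i)%:R * s n, (k i).+1%:R * s n[ ])); last first.
  by apply/seteqP; split=> mu /= ck i; [move=> _; exact: ck|exact: ck].
apply: fin_bigcap_measurable => // i _.
rewrite -[X in measurable X]setTI.
have mfq : measurable (f @^-1` (q n @^-1` [set i]) : set (borel X)).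
  by rewrite -[X in measurable X]setTI; apply: measurable_funPT => //; exact: mq.
by apply: (measurableT_comp (fine_measurable measurableT)
  (measurable_evaluation p_ge1 cX mfq)).
Qed.

End push_forward_borel.

(** * The push-forward of a measurable Gromov-Hausdorff approximation *)

Section push_forward_GHA.
Context {R : realType} (p : R).
Hypothesis p_ge1 : 1 <= p.
Context {G : topologicalGroupType} {X Y : pointedMetricType R}.
Hypotheses (cX : compact [set: X]) (cY : compact [set: Y]).
Variables (a : continuous_action G X) (b : continuous_action G Y).

Lemma borel_map_mdist (f : X -> Y) :
  borel_map mdist mdist f -> measurable_fun setT (f : borel X -> borel Y).
Proof.
move=> bf _ B mB; rewrite setTI; have := bf B.
by rewrite /dist_borel !dist_open_mdist; apply.
Qed.

(** Any bound larger than e would do in place of 2 e: half of the excess is the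
    mesh of the partition of Y whose cells, and their preimages under f, serve to
    transfer couplings in both directions. *)
Lemma measurable_GHA_push_forward (e : R) (f : X -> Y) :
  0 < e -> measurable_GHA mdist mdist a b e f ->
  exists F, measurable_GHA (@wasserstein R X p) (@wasserstein R Y p)
    (induced_action a) (induced_action b) (2 * e) F.
Proof.
move=> e0 [bf [isof surjf] equivf].
have mf := borel_map_mdist bf.
pose F (mu : borel_probability R X) : borel_probability R Y :=
  distribution mu (mfun_of mf).
have e20 : 0 < e / 2 by rewrite divr_gt0.
have [N [q [mq dq]]] := fine_labelling cY e20.
have mqf : measurable_labelling (q \o f : borel X -> 'I_N).
  move=> i; rewrite comp_preimage -[X in measurable X]setTI.
  exact: (mf measurableT _ (mq i)).
exists F; split; first exact: borel_map_distribution.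
- split=> [mu nu|nu].
    have up : wasserstein p (F mu) (F nu) <= wasserstein p mu nu + 2 * e.
      apply: (wasserstein_transfer p_ge1 cX cY mqf mq) => //; first by lra.
      move=> x x' y y' /= xy xy'.
      have := dq _ _ (esym xy); have := dq _ _ xy'; have := isof x x'; rewrite ler_norml.
      have := metric_triangle y (f x) y'; have := metric_triangle (f x) (f x') y'.
      lra.
    have lo : wasserstein p mu nu <= wasserstein p (F mu) (F nu) + 2 * e.
      apply: (wasserstein_transfer p_ge1 cY cX mq mqf) => //; first by lra.
      move=> y y' x x' /= xy xy'.
      have := dq _ _ (esym xy); have := dq _ _ xy'; have := isof x x'; rewrite ler_norml.
      have := metric_triangle (f x) y (f x'); have := metric_triangle y y' (f x').
      lra.
    by rewrite ler_norml; lra.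
  (* The measure nu is approximated by its push-forward under f \o (c \o q),
     which moves each cell to the image of a point of X chosen for that cell. *)
  have [c cP] : exists c : 'I_N -> X, forall y, mdist y (f (c (q y))) <= 2 * e.
    suff /choice[c cP] : forall i, exists x, forall y, q y = i -> mdist y (f x) <= 2 * e.
      by exists c => y; exact: cP.
    move=> i; have [[y0 y0i]|/forallNP noy] := pselect (exists y, q y = i); last first.
      by exists point => y /noy.
    have [x xP] := surjf y0; exists x => y yi.
    have := metric_triangle y y0 (f x); have := dq y y0; rewrite yi y0i => /(_ erefl).
    lra.
  have mc := @measurable_fun_labelling _ _ _ _ mq _ (borel X) c.
  have mfc : measurable_fun setT (f \o (c \o q) : borel Y -> borel Y).
    exact: (measurableT_comp mf mc).
  exists (distribution nu (mfun_of mc)).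
  have mid := @measurable_id _ (borel Y) setT.
  have nuE : distribution nu (mfun_of mid) = nu :> borel_probability R Y.
    exact: eq_borel_probability.
  have FnuE : distribution nu (mfun_of mfc) =
      F (distribution nu (mfun_of mc)) :> borel_probability R Y.
    exact: eq_borel_probability.
  rewrite -[X in wasserstein p X _]nuE -FnuE.
  by apply: wasserstein_distribution_le => //; lra.
- move=> g; apply: ge_ereal_sup => _ [mu _ <-]; rewrite lee_fin.
  have mbf := measurableT_comp (act_measurable b g) mf.
  have mfa := measurableT_comp mf (act_measurable a g).
  have -> : induced_action b g (F mu) =
      distribution mu (mfun_of mbf) :> borel_probability R Y.
    exact: eq_borel_probability.
  have -> : F (induced_action a g mu) =
      distribution mu (mfun_of mfa) :> borel_probability R Y.
    exact: eq_borel_probability.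
  apply: wasserstein_distribution_le => //; first by lra.
  move=> x /=; apply: (@le_trans _ _ e); last by lra.
  rewrite -lee_fin; apply: le_trans (equivf g); apply: ereal_sup_ubound.
  by exists x.
Qed.

End push_forward_GHA.

Section dmGH_lemmas.
Context {R : realType}.

Lemma dmGH_ge0 (X Y : Type) (dX : X -> X -> R) (dY : Y -> Y -> R) (G : Type)
    (a : G -> X -> X) (b : G -> Y -> Y) : (0 <= dmGH dX dY a b)%E.
Proof. by apply: le_ereal_inf_tmp => _ [e [e0 _ _] <-]; rewrite lee_fin ltW. Qed.

Lemma dmGH_induced_le (p : R) (G : topologicalGroupType)
    (X Y : pointedMetricType R)
    (a : continuous_action G X) (b : continuous_action G Y) :
  1 <= p -> compact [set: X] -> compact [set: Y] ->
  (dmGH (wasserstein p) (wasserstein p) (induced_action a) (induced_action b)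
   <= 2%:E * dmGH mdist mdist a b)%E.
Proof.
move=> p1 cX cY; rewrite -lee_pdivrMl//.
apply: le_ereal_inf_tmp => _ [e [e0 [f fP] [f' fP']] <-].
rewrite lee_pdivrMl// -EFinM; apply: ereal_inf_lbound.
exists (2 * e) => //; split.
- by rewrite mulr_gt0.
- exact: measurable_GHA_push_forward fP.
- exact: measurable_GHA_push_forward fP'.
Qed.

End dmGH_lemmas.

Theorem theorem1p2 (R : realType) (G : topologicalGroupType)
    (Xn : nat -> pointedMetricType R) (X : pointedMetricType R)
    (Xn_compact : forall n, compact [set: Xn n])
    (X_compact : compact [set: X])
    (alphan : forall n, continuous_action G (Xn n))
    (alpha : continuous_action G X)
    (p : R) (p_ge1 : 1 <= p) :
  (fun n => dmGH mdist mdist (alphan n) alpha) @ \oo --> 0%E ->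
  (fun n => dmGH (wasserstein p) (wasserstein p)
              (induced_action (alphan n)) (induced_action alpha)) @ \oo --> 0%E.
Proof.
move=> cvg0.
have cvg2 : (fun n => 2%:E * dmGH mdist mdist (alphan n) alpha)%E @ \oo --> 0%E.
  by rewrite -[X in _ --> X](mule0 2%:E); exact: cvgeZl.
apply: (squeeze_cvge _ (cvg_cst 0%E) cvg2).
by apply: nearW => n; rewrite dmGH_ge0 dmGH_induced_le.
Qed.
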